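(* Let $m,d$ be positive integers and $\mathbb{F}_q$ a finite field with $q$ elements such that $1<d<q-1$. Let $k:=\binom{m+d}{d}$ and let $\mathscr{V}_{m,d}$ be the Veronese variety given by the image of $\mathbb{P}^m(\mathbb{F}_q)$ in $\mathbb{P}^{k-1}(\mathbb{F}_q)$ under the Veronese map of degree $d$. Then $\mathscr{V}_{m,d}$ does not contain a (projective) line in $\mathbb{P}^{k-1}(\mathbb{F}_q)$.
   Context: The Veronese map of degree $d$ sends a point $[c_0:\dots:c_m]\in\mathbb{P}^m(\mathbb{F}_q)$ to the point of $\mathbb{P}^{k-1}(\mathbb{F}_q)$ whose homogeneous coordinates are the values at $(c_0,\dots,c_m)$ of all the $k=\binom{m+d}{d}$ monomials of degree $d$ in $m+1$ variables. The variety $\mathscr{V}_{m,d}$ is regarded as a set of $\mathbb{F}_q$-rational points, and a line in $\mathbb{P}^{k-1}(\mathbb{F}_q)$ is the set of its $q+1$ $\mathbb{F}_q$-rational points. *)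

(* Defs.v *)
From HB Require Import structures.
From mathcomp Require Import all_boot all_order all_algebra.

Set Implicit Arguments.
Unset Strict Implicit.
Unset Printing Implicit Defensive.

Import GRing.Theory.
Local Open Scope ring_scope.

Section ProjectiveSpace.

Variables (F : finFieldType) (n : nat).

(* Beware of the dimension shift: n is the number of homogeneous coordinates,
   so this is the set of F-rational points of P^(n-1). *)
Record projspace := ProjPoint {
  point_vs :> {vspace 'rV[F]_n};
  _ : \dim point_vs == 1%N
}.

HB.instance Definition _ := [isSub for point_vs].
HB.instance Definition _ := [Choice of projspace by <:].

Lemma dim_point (P : projspace) : \dim P = 1%N.
Proof. exact/eqP/(valP P). Qed.

Definition rep (P : projspace) : 'rV[F]_n := vpick P.

Lemma rep_neq0 P : rep P != 0.
Proof. by rewrite vpick0 -dimv_eq0 dim_point. Qed.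

Lemma line_rep P : <[rep P]>%VS = P.
Proof.
apply/eqP; rewrite eqEdim -memvE memv_pick dim_vline dim_point.
by rewrite -/(rep P) rep_neq0.
Qed.

Lemma dim_line_eq1 (v : 'rV[F]_n) : v != 0 -> \dim <[v]> == 1%N.
Proof. by move=> v0; rewrite dim_vline v0. Qed.

(* The point [v_0 : ... : v_(n-1)]. *)
Definition point_of (v : 'rV[F]_n) (v0 : v != 0) : projspace :=
  ProjPoint (dim_line_eq1 v0).

Lemma rep_pcancel : pcancel rep (fun v => insub <[v]>%VS).
Proof. by move=> P; rewrite line_rep -[point_vs P]/(val P) valK. Qed.

HB.instance Definition _ := PCanIsCountable rep_pcancel.
HB.instance Definition _ : isFinite projspace := PCanIsFinite rep_pcancel.

Definition proj_points (L : {vspace 'rV[F]_n}) : {set projspace} :=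
  [set P : projspace | (P <= L)%VS].

Definition proj_line (l : {set projspace}) : Prop :=
  exists2 L : {vspace 'rV[F]_n}, \dim L = 2 & l = proj_points L.

End ProjectiveSpace.

Section Veronese.

Variables (F : finFieldType) (m d : nat).

(* Exponent vectors of the monomials of degree d in m+1 variables. *)
Definition monomials : {set m.+1.-tuple 'I_d.+1} :=
  [set e : m.+1.-tuple 'I_d.+1 | \sum_(i <- e) i == d :> nat]%N.

Lemma card_monomials : 'C(m + d, d) = #|monomials|.
Proof. by rewrite card_ord_partitions -bin_sub ?leq_addl // addnK. Qed.

(* The exponent vector attached to the i-th coordinate of P^(k-1). *)
Definition monomial (i : 'I_('C(m + d, d))) : m.+1.-tuple 'I_d.+1 :=
  enum_val (cast_ord card_monomials i).

Definition veronese_row (c : 'rV[F]_m.+1) : 'rV[F]_('C(m + d, d)) :=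
  \row_i \prod_(j < m.+1) c 0 j ^+ tnth (monomial i) j.

Lemma sum_monomial i : (\sum_(j < m.+1) tnth (monomial i) j)%N = d.
Proof.
have := enum_valP (cast_ord card_monomials i).
by rewrite inE big_tuple => /eqP.
Qed.

Lemma veronese_rowZ a c : veronese_row (a *: c) = a ^+ d *: veronese_row c.
Proof.
apply/rowP => i; rewrite !mxE -[X in a ^+ X](sum_monomial i) -prodrXr.
rewrite -big_split /=.
by apply: eq_bigr => j _; rewrite mxE exprMn.
Qed.

Lemma veronese_row_neq0 c : c != 0 -> veronese_row c != 0.
Proof.
case/rV0Pn=> j0 cj0.
pose e : m.+1.-tuple 'I_d.+1 :=
  [tuple if j == j0 then ord_max else ord0 | j < m.+1].
have eM : e \in monomials.
  rewrite inE big_tuple (bigD1 j0) //= tnth_mktuple eqxx big1 ?addn0 //.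
  by move=> j /negPf jj0; rewrite tnth_mktuple jj0.
apply/rV0Pn; exists (cast_ord (esym card_monomials) (enum_rank_in eM e)).
rewrite mxE /monomial cast_ordKV enum_rankK_in //.
apply/prodf_neq0 => j _; rewrite tnth_mktuple.
by case: (eqVneq j j0) => [->|_]; rewrite ?expr0 ?oner_neq0 ?expf_neq0.
Qed.

(* Computed on a chosen representative; by veroneseE the choice is irrelevant. *)
Definition veronese (P : projspace F m.+1) : projspace F 'C(m + d, d) :=
  point_of (veronese_row_neq0 (rep_neq0 P)).

Lemma veroneseE (c : 'rV[F]_m.+1) (c0 : c != 0) :
  veronese (point_of c0) = point_of (veronese_row_neq0 c0).
Proof.
apply: val_inj => /=.
have /vlineP[a ra] : rep (point_of c0) \in <[c]>%VS by apply: memv_pick.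
have a0 : a != 0.
  by apply: contraNneq (rep_neq0 (point_of c0)) => a0; rewrite ra a0 scale0r.
rewrite ra veronese_rowZ; apply/eqP; rewrite eqEdim -memvE memvZ ?memv_line //=.
by rewrite !dim_vline scaler_eq0 expf_eq0 (negPf a0) andbF.
Qed.

Definition veronese_variety : {set projspace F 'C(m + d, d)} :=
  [set veronese P | P : projspace F m.+1].

End Veronese.

(* Main.v *)
Require Import Defs.
From mathcomp Require Import all_boot all_order all_algebra.

(** Any three distinct points of a Veronese variety of degree [d >= 2] are
    linearly independent: if the linear form [l1] vanishes at [c1] but not at
    [c3], and [l2] vanishes at [c2] but not at [c3], then the form
    [l1 ^ (d - 1) * l2] of degree [d], which is a linear functional of the
    Veronese coordinates, vanishes at [c1] and [c2] but not at [c3]. A line has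
    at least three points, any three of which are dependent. *)

Import GRing.Theory.

Section VeroneseIndependence.

Local Open Scope ring_scope.

Variables (F : finFieldType) (m d : nat).
Implicit Types c : 'rV[F]_m.+1.

Lemma monomial_surj (e : m.+1.-tuple 'I_d.+1) :
  e \in monomials m d -> exists i, monomial i = e.
Proof.
move=> eM; exists (cast_ord (esym (card_monomials m d)) (enum_rank_in eM e)).
by rewrite /monomial cast_ordKV enum_rankK_in.
Qed.

(** Grouping the factors by the value of [f] gives the variable [j] the size of the fibre of [f]
    over [j] as its exponent, and the fibre sizes add up to [d]. *)
Lemma prod_coord_veronese (f : 'I_d -> 'I_m.+1) :
  exists i, forall c, \prod_(t < d) c 0 (f t) = veronese_row d c 0 i.
Proof.
have fib_le j : (#|[pred t | f t == j]| < d.+1)%N.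
  by rewrite ltnS -[X in (_ <= X)%N]card_ord max_card.
pose e : m.+1.-tuple 'I_d.+1 := [tuple Ordinal (fib_le j) | j < m.+1].
have [|i ie] := @monomial_surj e.
  rewrite inE big_tuple; under eq_bigr do rewrite tnth_mktuple /= -sum1_card.
  apply/eqP; rewrite -[RHS]card_ord -sum1_card.
  by rewrite (partition_big f xpredT).
exists i => c; rewrite mxE ie (partition_big f xpredT) //=.
apply: eq_bigr => j _; rewrite tnth_mktuple /= -prodr_const.
by apply: eq_bigr => t /eqP ->.
Qed.

(** Distributivity expands the product into one term for each choice [f] of a variable in every
    factor. Each term is a constant times a Veronese coordinate, so [b] collects these constants. *)
Lemma prod_linear_veronese (a : 'I_d -> 'cV[F]_m.+1) :
  exists b : 'cV[F]_('C(m + d, d)), forall c,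
    \prod_(t < d) (c *m a t) 0 0 = (veronese_row d c *m b) 0 0.
Proof.
have /fin_all_exists[g gE] (f : {ffun 'I_d -> 'I_m.+1}) :=
  prod_coord_veronese f.
exists (\sum_(f : {ffun 'I_d -> 'I_m.+1})
          (\prod_(t < d) a t (f t) 0) *: delta_mx (g f) 0) => c.
under eq_bigr do rewrite mxE.
rewrite bigA_distr_bigA mulmx_sumr summxE; apply: eq_bigr => f _.
by rewrite big_split /= gE -scalemxAr -colE !mxE mulrC.
Qed.

(** The columns of [cokermx u] vanish at [u], and only multiples of [u] are killed by all of
    them. *)
Lemma separating_form n (u v : 'rV[F]_n) : v \notin <[u]>%VS ->
  exists2 a : 'cV[F]_n, u *m a = 0 & (v *m a) 0 0 != 0.
Proof.
move=> vu; have : v *m cokermx u != 0.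
  rewrite -submxE; apply: contra vu => /sub_rVP[k ->].
  by rewrite memvZ ?memv_line.
case/rV0Pn=> j vj; exists (cokermx u *m delta_mx j 0).
  by rewrite mulmxA mulmx_coker mul0mx.
by rewrite mulmxA -colE mxE.
Qed.

Lemma veronese_row_independent c1 c2 c3 : (1 < d)%N ->
  c3 \notin <[c1]>%VS -> c3 \notin <[c2]>%VS ->
  veronese_row d c3 \notin (<[veronese_row d c1]> + <[veronese_row d c2]>)%VS.
Proof.
move=> d_gt1 c31 c32.
have [a1 a1c1 a1c3] := separating_form _ _ _ c31.
have [a2 a2c2 a2c3] := separating_form _ _ _ c32.
(* The indices 0 and 1 are both available because [1 < d]: the factor at [t1] kills [c1], the one at
   [t2] kills [c2]. *)
pose t1 := Ordinal (ltnW d_gt1); pose t2 := Ordinal d_gt1.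
have [b bE] := prod_linear_veronese
  (fun t => if t == t2 then a2 else a1).
apply/negP=> /memv_addP[_ /vlineP[k1 ->] [_ /vlineP[k2 ->]]].
move/(congr1 (fun v => (v *m b) 0 0)).
have zmx00 : (0 : 'M[F]_1) 0 0 = 0 by rewrite mxE.
rewrite mulmxDl -!scalemxAl [RHS]mxE [X in X + _]mxE [X in _ + X]mxE -!bE.
rewrite (bigD1 t1 (F := fun t => (c1 *m _) 0 0)) //= a1c1 zmx00 mul0r mulr0.
rewrite (bigD1 t2 (F := fun t => (c2 *m _) 0 0)) //= a2c2 zmx00 mul0r mulr0.
rewrite addr0.
apply/eqP/prodf_neq0 => t _.
by case: ifP.
Qed.

Lemma veronese_row_line c1 c2 :
  c1 \in <[c2]>%VS -> veronese_row d c1 \in <[veronese_row d c2]>%VS.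
Proof. by move=> /vlineP[k ->]; rewrite veronese_rowZ memvZ ?memv_line. Qed.

Lemma veronese_varietyP (P : projspace F 'C(m + d, d)) :
  P \in veronese_variety F m d ->
  exists c, point_vs P = <[veronese_row d c]>%VS.
Proof. by case/imsetP=> Q _ ->; exists (rep Q). Qed.

End VeroneseIndependence.

Lemma dimv2_pair (K : fieldType) (vT : vectType K) (L : {vspace vT}) :
  \dim L = 2 -> exists u w,
    [/\ L = (<[u]> + <[w]>)%VS, u \notin <[w]>%VS & w \notin <[u]>%VS].
Proof.
move=> dimL.
have [u [w LE]] : exists u w, L = (<[u]> + <[w]>)%VS.
  move: (span_basis (vbasisP L)) (size_tuple (vbasis L)) dimL.
  case: (tval _) => [|u [|w [|? ?]]] LE /= <- // _; exists u, w.
  by rewrite -LE span_cons span_seq1.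
(* If one generator were a multiple of the other, the sum would have dimension at most 1. *)
exists u, w; split=> //; apply/negP; rewrite memvE => /addv_idPr uw.
  by move: dimL; rewrite LE uw dim_vline; case: (_ != _).
by move: dimL; rewrite LE addvC uw dim_vline; case: (_ != _).
Qed.

Theorem corollary4p9 (F : finFieldType) (m d : nat)
  (m_gt0 : 0 < m) (d_gt0 : 0 < d) (d_gt1 : 1 < d) (d_lt : d < #|F| - 1) :
  ~ (exists2 l : {set projspace F 'C(m + d, d)},
       proj_line l & l \subset veronese_variety F m d).
Proof.
case=> l [L /dimv2_pair[u [w [LE uw wu]]] ->] /subsetP LV.
have on_variety v : v \in L -> v != 0%R ->
    exists c, <[v]>%VS = <[veronese_row d c]>%VS.
  move=> vL v0; apply: (@veronese_varietyP _ _ _ (point_of v0)).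
  by apply: LV; rewrite inE -memvE.
(* The vector [u + w] spans a third point of the line, different from those of [u] and [w]. *)
have uwu : (u + w)%R \notin <[u]>%VS by rewrite rpredDl ?memv_line.
have uww : (u + w)%R \notin <[w]>%VS by rewrite rpredDr ?memv_line.
have neq0 (x y : 'rV[F]_('C(m + d, d))) : x \notin <[y]>%VS -> x != 0%R.
  by apply: contraNneq => ->; rewrite mem0v.
have uL : u \in L by rewrite LE (subvP (addvSl _ _)) ?memv_line.
have wL : w \in L by rewrite LE (subvP (addvSr _ _)) ?memv_line.
have [c1 E1] := on_variety u uL (neq0 _ _ uw).
have [c2 E2] := on_variety w wL (neq0 _ _ wu).
have [c3 E3] := on_variety _ (rpredD uL wL) (neq0 _ _ uwu).
(* Proportional parameters have proportional images, so distinct image points come from distinct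
   parameter points. *)
have c31 : c3 \notin <[c1]>%VS.
  apply: contra uwu => /(veronese_row_line _ _ d).
  by rewrite E1 !memvE -E3.
have c32 : c3 \notin <[c2]>%VS.
  apply: contra uww => /(veronese_row_line _ _ d).
  by rewrite E2 !memvE -E3.
have := veronese_row_independent _ _ _ _ _ _ d_gt1 c31 c32.
by rewrite -E1 -E2 -LE memvE -E3 -memvE rpredD.
Qed.
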